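(* Let $S_{16}$ be the $16\times 16$ complex Hadamard matrix with entries $[S_{16}]_{j,l}=e^{2\pi \mathbf{i}\,E_{j,l}/8}$, where $\mathbf{i}$ is the imaginary unit and $$E=\left[\begin{array}{cccccccccccccccc} 0 & 0 & 0 & 0 & 0 & 0 & 0 & 0 & 0 & 0 & 0 & 0 & 0 & 0 & 0 & 0 \\ 0 & 4 & 1 & 5 & 2 & 6 & 3 & 7 & 0 & 4 & 1 & 5 & 2 & 6 & 3 & 7 \\ 0 & 4 & 3 & 7 & 6 & 2 & 1 & 5 & 0 & 4 & 3 & 7 & 6 & 2 & 1 & 5 \\ 0 & 0 & 4 & 4 & 0 & 0 & 4 & 4 & 0 & 0 & 4 & 4 & 0 & 0 & 4 & 4 \\ 0 & 4 & 5 & 1 & 2 & 6 & 7 & 3 & 0 & 4 & 5 & 1 & 2 & 6 & 7 & 3 \\ 0 & 0 & 6 & 6 & 4 & 4 & 2 & 2 & 0 & 0 & 6 & 6 & 4 & 4 & 2 & 2 \\ 0 & 4 & 7 & 3 & 6 & 2 & 5 & 1 & 0 & 4 & 7 & 3 & 6 & 2 & 5 & 1 \\ 0 & 0 & 2 & 2 & 4 & 4 & 6 & 6 & 2 & 2 & 4 & 4 & 6 & 6 & 0 & 0 \\ 0 & 1 & 0 & 1 & 0 & 1 & 0 & 1 & 4 & 5 & 4 & 5 & 4 & 5 & 4 & 5 \\ 0 & 5 & 0 & 5 & 0 & 5 & 0 & 5 & 4 & 1 & 4 & 1 & 4 & 1 & 4 & 1 \\ 0 & 4 & 2 & 6 &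 4 & 0 & 6 & 2 & 4 & 0 & 6 & 2 & 0 & 4 & 2 & 6 \\ 0 & 0 & 4 & 4 & 0 & 0 & 4 & 4 & 4 & 4 & 0 & 0 & 4 & 4 & 0 & 0 \\ 0 & 4 & 4 & 0 & 0 & 4 & 4 & 0 & 4 & 0 & 0 & 4 & 4 & 0 & 0 & 4 \\ 0 & 0 & 6 & 6 & 4 & 4 & 2 & 2 & 4 & 4 & 2 & 2 & 0 & 0 & 6 & 6 \\ 0 & 4 & 6 & 2 & 4 & 0 & 2 & 6 & 4 & 0 & 2 & 6 & 0 & 4 & 6 & 2 \\ 0 & 0 & 2 & 2 & 4 & 4 & 6 & 6 & 6 & 6 & 0 & 0 & 2 & 2 & 4 & 4 \end{array}\right].$$ Then neither $S_{16}$ nor its transpose $S_{16}^T$ is Dita-type.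
   Context: A complex Hadamard matrix of order $r$ is an $r\times r$ complex matrix all of whose entries have absolute value $1$ and whose rows are pairwise orthogonal with respect to the standard Hermitian inner product. Two complex Hadamard matrices $K_1,K_2$ are equivalent if $K_1=D_1P_1K_2P_2D_2$ for some unitary diagonal matrices $D_1,D_2$ and permutation matrices $P_1,P_2$. A complex Hadamard matrix of order $N$ is called Dita-type if, for some integers $k,n\ge 2$ with $kn=N$, it is equivalent to a block matrix $$K=\begin{bmatrix} m_{11}N_1&\cdots&m_{1k}N_k\\ \vdots&&\vdots\\ m_{k1}N_1&\cdots&m_{kk}N_k\end{bmatrix},$$ where $M=(m_{ij})$ is some $k\times k$ complex Hadamard matrix and $N_1,\dots,N_k$ are some $n\times n$ complex Hadamard matrices (possibly different from each other). *)

(* Defs.v *)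
From mathcomp Require Export all_boot all_order all_algebra.
From mathcomp Require Export complex.
From mathcomp Require Export reals trigo.
From mathcomp Require Import ring.

Set Implicit Arguments.
Unset Strict Implicit.
Unset Printing Implicit Defensive.

Import Order.TTheory GRing.Theory Num.Theory.
Local Open Scope ring_scope.

(* [dotmx u v] is the standard Hermitian product \sum_l u_l * (v_l)^*. *)
Definition complex_hadamard (C : numClosedFieldType) (r : nat)
    (A : 'M[C]_r) : Prop :=
  (forall i j, `|A i j| = 1) /\
  (forall i j, i != j -> dotmx (row i A) (row j A) = 0).

Definition hadamard_equiv (C : numClosedFieldType) (r : nat)
    (K1 K2 : 'M[C]_r) : Prop :=
  exists D1 P1 P2 D2 : 'M[C]_r,
  [/\ is_diag_mx D1 /\ D1 \is unitarymx,
      is_diag_mx D2 /\ D2 \is unitarymx,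
      is_perm_mx P1,
      is_perm_mx P2
    & K1 = D1 *m P1 *m K2 *m P2 *m D2].

Lemma sum_const_ord (k n : nat) : (\sum_(i < k) n = k * n)%N.
Proof. by rewrite sum_nat_const card_ord. Qed.

(* The block matrix with (i, j) block M i j *: Ns j; the cast only replaces the
   size \sum_(i < k) n carried by \mxblock with k * n. *)
Definition dita_block (C : numClosedFieldType) (k n : nat)
    (M : 'M[C]_k) (Ns : 'I_k -> 'M[C]_n) : 'M[C]_(k * n) :=
  castmx (sum_const_ord k n, sum_const_ord k n)
    (\mxblock_(i < k, j < k) (M i j *: Ns j)).

(* K is not separately required to be Hadamard: the block matrix is, and
   equivalence preserves this. *)
Definition dita_type (C : numClosedFieldType) (N : nat)
    (K : 'M[C]_N) : Prop :=
  exists (k n : nat) (kn : (k * n)%N = N)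
         (M : 'M[C]_k) (Ns : 'I_k -> 'M[C]_n),
  [/\ (2 <= k)%N, (2 <= n)%N, complex_hadamard M,
      (forall j, complex_hadamard (Ns j))
    & hadamard_equiv K (castmx (kn, kn) (dita_block M Ns))].

(* exp (i t) for real t *)
Definition expi (R : realType) (t : R) : R[i] := (cos t +i* sin t)%C.

Definition E16 : seq (seq nat) := [::
  [:: 0; 0; 0; 0; 0; 0; 0; 0; 0; 0; 0; 0; 0; 0; 0; 0];
  [:: 0; 4; 1; 5; 2; 6; 3; 7; 0; 4; 1; 5; 2; 6; 3; 7];
  [:: 0; 4; 3; 7; 6; 2; 1; 5; 0; 4; 3; 7; 6; 2; 1; 5];
  [:: 0; 0; 4; 4; 0; 0; 4; 4; 0; 0; 4; 4; 0; 0; 4; 4];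
  [:: 0; 4; 5; 1; 2; 6; 7; 3; 0; 4; 5; 1; 2; 6; 7; 3];
  [:: 0; 0; 6; 6; 4; 4; 2; 2; 0; 0; 6; 6; 4; 4; 2; 2];
  [:: 0; 4; 7; 3; 6; 2; 5; 1; 0; 4; 7; 3; 6; 2; 5; 1];
  [:: 0; 0; 2; 2; 4; 4; 6; 6; 2; 2; 4; 4; 6; 6; 0; 0];
  [:: 0; 1; 0; 1; 0; 1; 0; 1; 4; 5; 4; 5; 4; 5; 4; 5];
  [:: 0; 5; 0; 5; 0; 5; 0; 5; 4; 1; 4; 1; 4; 1; 4; 1];
  [:: 0; 4; 2; 6; 4; 0; 6; 2; 4; 0; 6; 2; 0; 4; 2; 6];
  [:: 0; 0; 4; 4; 0; 0; 4; 4; 4; 4; 0; 0; 4; 4; 0; 0];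
  [:: 0; 4; 4; 0; 0; 4; 4; 0; 4; 0; 0; 4; 4; 0; 0; 4];
  [:: 0; 0; 6; 6; 4; 4; 2; 2; 4; 4; 2; 2; 0; 0; 6; 6];
  [:: 0; 4; 6; 2; 4; 0; 2; 6; 4; 0; 2; 6; 0; 4; 6; 2];
  [:: 0; 0; 2; 2; 4; 4; 6; 6; 6; 6; 0; 0; 2; 2; 4; 4]]%N.

Definition S16 (R : realType) : 'M[R[i]]_16 :=
  \matrix_(j < 16, l < 16)
    expi (2%:R * pi * (nth 0%N (nth [::] E16 j) l)%:R / 8%:R).

Section S16Hadamard.
Variable R : realType.
Implicit Types (s t : R).

Lemma expiD s t : expi (s + t) = expi s * expi t.
Proof.
rewrite /expi cosD sinD; apply/eqP; rewrite eq_complex /=.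
by rewrite eqxx addrC eqxx.
Qed.

Lemma expi_conjM t : expi t * (expi t)^* = 1.
Proof.
apply/eqP; rewrite eq_complex /=.
by rewrite !mulrN opprK -!expr2 cos2Dsin2 eqxx [sin t * _]mulrC addrC subrr eqxx.
Qed.

Lemma normr_expi t : `|expi t| = 1.
Proof.
by apply/eqP; rewrite -(@eqrXn2 _ 2) // expr1n normCK expi_conjM.
Qed.

Let z : R[i] := expi (2%:R * pi / 8%:R).

Let zX (e : nat) : expi (2%:R * pi * e%:R / 8%:R) = z ^+ e.
Proof.
elim: e => [|e IHe].
  rewrite mulr0 mul0r expr0 /expi cos0 sin0; exact/eqP.
by rewrite exprS -IHe -expiD; congr expi; rewrite -natr1; ring.
Qed.

Let z4 : z ^+ 4 = -1.
Proof.
have -> : z ^+ 4 = expi pi.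
  by rewrite -zX; congr expi; field.
by rewrite /expi cospi sinpi; apply/eqP; rewrite eq_complex /= oppr0 !eqxx.
Qed.

Let z8 : z ^+ 8 = 1.
Proof. by rewrite (exprM z 4 2) z4 sqrrN expr1n. Qed.

Let zmod (e : nat) : z ^+ e = z ^+ (e %% 8).
Proof. by rewrite {1}(divn_eq e 8) exprD mulnC exprM z8 expr1n mul1r. Qed.

Let zconj (e : nat) : (z ^+ e)^* = z ^+ (7 * e).
Proof.
have zu : z ^+ e != 0 by rewrite expf_neq0 // -normr_gt0 normr_expi.
apply: (mulfI zu); rewrite -{1 2}zX expi_conjM -exprD -mulSn exprM z8.
by rewrite expr1n.
Qed.

Let zsum (s : seq nat) : \sum_(a <- s) z ^+ a =
  \sum_(m < 4) z ^+ m * ((count (fun a => a %% 8 == m)%N s)%:R -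
                         (count (fun a => a %% 8 == m + 4)%N s)%:R).
Proof.
elim: s => [|a s IHs].
  by rewrite big_nil big1 // => m _; rewrite subrr mulr0.
rewrite big_cons IHs zmod !big_ord_recl !big_ord0 /= !natrD.
rewrite /bump /=.
have e m : z ^+ (4 + m) = - z ^+ m by rewrite exprD z4 mulN1r.
have := ltn_mod a 8; move: (a %% 8)%N => r.
do 4![case: r => [_|r] /=; first by ring].
do 4![case: r => [_|r] /=; first by rewrite (e 0, e 1, e 2, e 3)%N; ring].
by [].
Qed.

Lemma S16_hadamard : complex_hadamard (S16 R).
Proof.
split=> [i j|i j ij]; first by rewrite mxE normr_expi.
pose E (i j : nat) := nth 0%N (nth [::] E16 i) j.
pose s (i j : nat) := [seq (E i l + 7 * E j l)%N | l <- iota 0 16].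
have -> : dotmx (row i (S16 R)) (row j (S16 R)) = \sum_(a <- s i j) z ^+ a.
  rewrite dotmxE mxE big_map -[iota 0 16]/(index_iota 0 16) big_mkord.
  by apply: eq_bigr => l _; rewrite !mxE !zX zconj exprD.
have chk : all (fun i => all (fun j => (i == j) || all (fun m =>
    count (fun a => a %% 8 == m)%N (s i j) ==
    count (fun a => a %% 8 == m + 4)%N (s i j)) (iota 0 4))
  (iota 0 16)) (iota 0 16) by vm_compute.
rewrite zsum big1 // => m _.
have mi (n : nat) (x : 'I_n) : (x : nat) \in iota 0 n by rewrite mem_iota /=.
have /allP/(_ _ (mi _ j)) := allP chk _ (mi _ i).
rewrite (_ : (i == j :> nat) = false); last exact: negbTE.
by move/allP/(_ _ (mi _ m))/eqP=> ->; rewrite subrr mulr0.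
Qed.

End S16Hadamard.

(* Main.v *)
(* In a Dita-type matrix of order kn the rows split into n classes of size k and
   the columns into k classes of size n so that the entries in each row class
   times column class form a rank one matrix; up to exchanging k and n, this is
   symmetric under transposition. Hence the ratio of two columns in the same
   class takes each value a multiple of k times. For S16, k is even, and the only
   column whose ratio to column 0 takes every value an even number of times is
   column 4; so n = 2 and k = 8, but some value occurs exactly 6 times there. *)

Require Import Defs.
From mathcomp Require Import perm ring.
Local Open Scope ring_scope.

Set Implicit Arguments.
Unset Strict Implicit.
Unset Printing Implicit Defensive.

Import Order.TTheory GRing.Theory Num.Theory.

(* The coordinates f and g label the rows and the columns by 'I_k * 'I_n: row
   (i, a) and column (j, b) of the block matrix meet in M i j * Ns j a b, which
   for fixed a and j is the product of a function of i and a function of b. *)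
Definition rank1_classes (C : comNzRingType) (N k n : nat) (K : 'M[C]_N)
    (f g : 'I_N -> 'I_k * 'I_n) :=
  forall r r' c c', (f r).2 = (f r').2 -> (g c).1 = (g c').1 ->
    K r c * K r' c' = K r c' * K r' c.

Definition grid_rank1 (C : comNzRingType) (N : nat) (K : 'M[C]_N) (k n : nat) :=
  exists f g : 'I_N -> 'I_k * 'I_n,
    [/\ bijective f, bijective g & rank1_classes K f g].

(** Row classes are read off the second coordinate and column classes off the first, so transposing
    has to swap the coordinates, and with them k and n. *)
Lemma grid_rank1_tr (C : comNzRingType) N (K : 'M[C]_N) k n :
  grid_rank1 K^T k n -> grid_rank1 K n k.
Proof.
have swap_bij p q (f : 'I_N -> 'I_p * 'I_q) :
    bijective f -> bijective (fun r => ((f r).2, (f r).1)).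
  by case=> h fK hK; exists (fun x => h (x.2, x.1)) => x /=;
    [rewrite -surjective_pairing fK | rewrite hK; case: x].
move=> [f [g [/swap_bij f_bij /swap_bij g_bij rk1]]].
exists (fun c => ((g c).2, (g c).1)), (fun r => ((f r).2, (f r).1)).
split=> // r r' c c' /= grr' fcc'.
by have := rk1 c c' r r' fcc' grr'; rewrite !mxE => ->; rewrite mulrC.
Qed.

(** Permutations only relabel rows and columns, and the diagonal factors multiply both sides of a
    rank one identity by the same scalar. *)
Lemma grid_rank1_equiv (C : numClosedFieldType) N (K1 K2 : 'M[C]_N) k n :
  hadamard_equiv K1 K2 -> grid_rank1 K2 k n -> grid_rank1 K1 k n.
Proof.
move=> [_ [_ [_ [_ [[/diag_mxP[d1 ->] _] [/diag_mxP[d2 ->] _]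
  /is_perm_mxP[s ->] /is_perm_mxP[t ->] ->]]]]] [f [g [f_bij g_bij rk1]]].
exists (f \o s), (g \o t^-1%g); split.
- exact: bij_comp f_bij (injF_bij perm_inj).
- exact: bij_comp g_bij (injF_bij perm_inj).
move=> r r' c c' /= frr' gcc'.
rewrite -!mulmxA mul_diag_mx !mulmxA mul_mx_diag -row_permE -[t]invgK -col_permE.
rewrite !mxE; move/(_ _ _ _ _ frr' gcc'): rk1 => e.
transitivity (d1 0 r * d1 0 r' * d2 0 c * d2 0 c' *
  (K2 (s r) ((t^-1)%g c) * K2 (s r') ((t^-1)%g c'))); first by ring.
by rewrite e; ring.
Qed.

Lemma grid_rank1_dita_block (C : numClosedFieldType) k n (M : 'M[C]_k)
  (Ns : 'I_k -> 'M[C]_n) : grid_rank1 (dita_block M Ns) k n.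
Proof.
pose h (r : 'I_(k * n)) : 'I_k * 'I_n :=
  let x := cast_ord (esym (sum_const_ord k n)) r in
  (tagnat.sig1 x, tagnat.sig2 x).
have h_bij : bijective h.
  apply: inj_card_bij; last by rewrite card_prod !card_ord.
  move=> r r' []; rewrite /tagnat.sig1 /tagnat.sig2.
  move=> e1 e2; apply: (@cast_ord_inj _ _ (esym (sum_const_ord k n))).
  apply: (can_inj tagnat.sigK); move: e1 e2.
  by case: (tagnat.sig _) => i a; case: (tagnat.sig _) => j b /= -> ->.
exists h, h; split=> // r r' c c' /= e2 e1.
by rewrite /dita_block !castmxE !mxE /= e1 e2; ring.
Qed.

Lemma dita_type_grid (C : numClosedFieldType) N (K : 'M[C]_N) : dita_type K ->
  exists k n, [/\ (2 <= k)%N, (2 <= n)%N, (k * n)%N = N & grid_rank1 K k n].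
Proof.
move=> [k [n [kn [M [Ns [k2 n2 _ _ eqK]]]]]]; exists k, n; split=> //.
apply: grid_rank1_equiv eqK _; case: N / kn K => K; rewrite castmx_id.
exact: grid_rank1_dita_block.
Qed.

(* The set counted below is a union of classes of rows with equal (f _).2. *)
Lemma grid_rank1_dvdn_card (C : fieldType) N (K : 'M[C]_N) k n
    (f g : 'I_N -> 'I_k * 'I_n) (x : C) (c c' : 'I_N) :
  bijective f -> (forall r c, K r c != 0) ->
  rank1_classes K f g ->
  (g c).1 = (g c').1 ->
  (k %| #|[pred r | (K r c' == x * K r c)%R]|)%N.
Proof.
move=> [h fK hK] K0 rk1 gcc'; set P := [pred r | _].
(* Nonzero entries cancel in the rank one identity, so the ratio of the two columns is constant on
   each row class. *)
have Pf r r' : (f r).2 = (f r').2 -> P r -> P r'.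
  move=> frr' /eqP Kr; apply/eqP/(mulfI (K0 r c)).
  by rewrite (rk1 r r' c c') // Kr; ring.
pose W := [set y.2 | y in [set f r | r in P]].
suff -> : #|P| = #|setX [set: 'I_k] W|.
  by rewrite cardsX cardsT card_ord dvdn_mulr.
rewrite -(card_imset P (can_inj fK)); apply: eq_card => -[i a].
apply/imsetP/setXP => [[r Pr e]|[_ /imsetP[_ /imsetP[r Pr ->] a2]]].
  split; first by rewrite inE.
  by rewrite -[a]/(i, a).2 e; apply: imset_f; apply: imset_f.
exists (h (i, a)); last by rewrite hK.
by apply: Pf Pr; rewrite hK.
Qed.

Local Notation exp16 j l := (nth 0%N (nth [::] E16 j) l).

Section S16.
Variable R : realType.
Let z : R[i] := expi (2%:R * pi / 8%:R).

Lemma S16E j l : S16 R j l = z ^+ exp16 j l.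
Proof.
rewrite mxE; elim: (exp16 j l) => [|e IHe].
  by rewrite mulr0 mul0r expr0 /expi cos0 sin0.
by rewrite exprS -IHe -expiD; congr expi; rewrite -natr1; ring.
Qed.

Lemma prim_root_expi8 : 8.-primitive_root z.
Proof.
have zX2 : z ^+ 2 = expi (pi / 2%:R).
  by rewrite expr2 -expiD; congr expi; field.
have z4 : z ^+ 4 = -1.
  rewrite (exprM z 2 2) zX2 expr2 -expiD -splitr /expi cospi sinpi.
  by apply/eqP; rewrite eq_complex /= oppr0 !eqxx.
have z8 : z ^+ 8 = 1 by rewrite (exprM z 4 2) z4 sqrrN expr1n.
have [//|m pm m8] := @prim_order_exists _ 8 z _ z8.
(* The order [m] of [z] divides 8, and every divisor of 8 except 8 itself divides 4. *)
suff: ~~ (m %| 4)%N.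
  by case: m m8 pm => [|[|[|[|[|[|[|[|[|m]]]]]]]]] //; move/dvdn_leq => /(_ isT).
by rewrite (prim_order_dvd pm) z4 eq_sym -addr_eq0 -mulr2n pnatr_eq0.
Qed.

End S16.

(** The number of rows in which column [c] of [S16] is e^(2 pi i v / 8) times column 0. *)
Definition exp16_count (c v : nat) : nat :=
  count (fun r => exp16 r c == v + exp16 r 0 %[mod 8])%N (iota 0 16).

Lemma S16_column0 (R : realType) k n (f g : 'I_16 -> 'I_k * 'I_n) c v :
  bijective f ->
  rank1_classes (S16 R) f g ->
  (g 0).1 = (g c).1 -> (k %| exp16_count c v)%N.
Proof.
move=> f_bij rk1 g0c; have prim := prim_root_expi8 R.
have S0 r l : S16 R r l != 0.
  by rewrite -normr_gt0 (S16_hadamard R).1.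
have := grid_rank1_dvdn_card (expi (2%:R * pi / 8%:R) ^+ v) f_bij S0 rk1 g0c.
congr (_ %| _)%N; rewrite /exp16_count -val_enum_ord count_map cardE enumT.
rewrite size_filter; apply: eq_count => r /=.
by rewrite inE !S16E -exprD (eq_prim_root_expr prim).
Qed.

Lemma S16_not_grid_rank1 (R : realType) k n :
  (2 <= k)%N -> (2 <= n)%N -> (k * n = 16)%N -> ~ grid_rank1 (S16 R) k n.
Proof.
move=> k2 n2 kn [f [g [f_bij g_bij rk1]]].
have count0 c v : (g 0).1 = (g c).1 -> (k %| exp16_count c v)%N.
  exact: S16_column0 f_bij rk1.
have [h gK hK] := g_bij.
have k_even : (2 %| k)%N.
  have /(dvdn_pfactor _ 4 (isT : prime 2))[[|m] _ kE] : (k %| 2 ^ 4)%N.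
  - by rewrite -[(2 ^ 4)%N]kn dvdn_mulr.
  - by rewrite kE in k2.
  - by rewrite kE dvdn_exp.
(* The class of column 0, enumerated through the inverse [h] of [g]. *)
pose block : {set 'I_16} := [set h ((g 0).1, a) | a : 'I_n].
have block_count c v : c \in block -> (k %| exp16_count c v)%N.
  by case/imsetP=> a _ ->; apply: count0; rewrite hK.
have card_block : #|block| = n.
  rewrite card_imset ?card_ord // => a b /(can_inj hK) [] //.
(* For every column other than 0 and 4, some ratio to column 0 occurs an odd number of times. *)
have chk4 : all (fun c => [|| c == 0, c == 4 |
    ~~ all (fun v => 2 %| exp16_count c v) (iota 0 8)])%N (iota 0 16).
  by vm_compute.
have sub04 : block \subset [set inord 0; inord 4].
  apply/subsetP => c cb; have := allP chk4 c.
  rewrite mem_iota leq0n add0n ltn_ord => /(_ isT)/or3P[c0|c4|/negP[]].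
  - by rewrite !inE -[c == _]val_eqE /= inordK // c0.
  - by rewrite !inE -[c == inord 4]val_eqE /= inordK // c4 orbT.
  - by apply/allP => v _; apply: dvdn_trans k_even _; apply: block_count.
have n_eq2 : n = 2%N.
  apply/eqP; rewrite eqn_leq n2 andbT -card_block.
  by apply: leq_trans (subset_leq_card sub04) _; rewrite cards2; case: (_ != _).
have k8 : k = 8%N.
  by apply/eqP; rewrite -(@eqn_pmul2r 2) // -[X in (_ * X)%N]n_eq2 kn.
have /subsetPn[c cb c0] : ~~ (block \subset [set inord 0]).
  by apply: contraL n2 => /subset_leq_card; rewrite card_block cards1 -ltnNge.
have c4 : c = inord 4.
  by apply/eqP; have := subsetP sub04 c cb; rewrite !inE in c0 *; rewrite (negPf c0).
(* The ratio 1 occurs six times in column 4, and 8 does not divide 6. *)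
have := block_count c 0%N cb; rewrite c4 k8 inordK //.
Qed.

Theorem proposition3p3 (R : realType) :
  ~ dita_type (S16 R) /\ ~ dita_type (S16 R)^T.
Proof.
split=> /dita_type_grid[k [n [k2 n2 kn]]]; first exact: S16_not_grid_rank1.
by move/grid_rank1_tr; apply: S16_not_grid_rank1; rewrite // mulnC.
Qed.
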